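(* Let $f,g\colon X\to\overline{\mathbb{R}}$ be proper functions with $g$ e-convex. If $a\in X$ is a global minimizer of $f-g$, then $\partial_{c,\varepsilon}g(a)\subseteq\partial_{c,\varepsilon}f(a)$ for all $\varepsilon\ge0$.
   Context: $X$ is a nontrivial separated (Hausdorff) real locally convex space with continuous dual $X^*$; $X$ carries the topology $\sigma(X,X^* )$ and $X^*$ the topology $\sigma(X^*,X)$; $\langle x,x^*\rangle$ is the value of $x^*\in X^*$ at $x\in X$. $\overline{\mathbb{R}}=\mathbb{R}\cup\{\pm\infty\}$. $W:=X^*\times X^*\times\mathbb{R}$. For an extended-real-valued function $h$, $\operatorname{dom}h=\{h<+\infty\}$; $h$ is proper if it never takes the value $-\infty$ and $\operatorname{dom}h\neq\emptyset$. The function $f-g$ is defined pointwise with the convention $(+\infty)-(+\infty)=+\infty$. A point $a\in X$ is a global minimizer of $h\colon X\to\overline{\mathbb{R}}$ if $a\in\operatorname{dom}h$ and $h(a)\le h(x)$ for all $x\in X$ (the value $h(a)=-\infty$ is allowed). A subset $C$ of a locally convex space $Y$ is e-convex if for every $y_0\notin C$ there is $y^*\in Y^*$ with $\langle y-y_0,y^*\rangle<0$ for all $y\in C$. A function $g\colon X\to\overline{\mathbb{R}}$ is e-convex if its epigraph $\{(x,r)\in X\times\mathbb{R}:g(x)\le r\}$ is e-convex in $X\times\mathbb{R}$. Coupling function: $c(x,(x^*,u^*,\alpha)):=\langle x,x^*\rangle$ if $\langle x,u^*\rangle<\alpha$, and $+\infty$ otherwise. $\varepsilon$-$c$-subdifferential: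 for $h\colon X\to\overline{\mathbb{R}}$ proper with $h(x_0)\in\mathbb{R}$ and $\varepsilon\ge0$, $\partial_{c,\varepsilon}h(x_0)$ is the set of $w=(x^*,u^*,\alpha)\in W$ such that $\langle x_0,u^*\rangle<\alpha$ and $h(x)-h(x_0)\ge c(x,w)-c(x_0,w)-\varepsilon$ for all $x\in X$; if $h(x_0)\notin\mathbb{R}$, $\partial_{c,\varepsilon}h(x_0)=\emptyset$. *)

(* Defs.v *)
From HB Require Import structures.
From mathcomp Require Import all_boot all_order all_algebra.
From mathcomp Require Import all_classical all_reals all_analysis.

Set Implicit Arguments.
Unset Strict Implicit.
Unset Printing Implicit Defensive.

Import Order.TTheory GRing.Theory Num.Theory.
Import numFieldNormedType.Exports.

Local Open Scope classical_set_scope.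
Local Open Scope ring_scope.

(* In MathComp-Analysis, [tvsType R] is the type of locally convex topological
   vector spaces over R; separatedness is not part of it. *)

Record cdual (R : realType) (Y : tvsType R) := CDual {
  cdual_fun :> {linear Y -> R^o};
  cdual_continuous : continuous cdual_fun }.

Definition nontrivial (R : realType) (X : tvsType R) := exists x : X, x != 0.

Definition edom (R : realType) (X : tvsType R) (h : X -> \bar R) : set X :=
  [set x | (h x < +oo)%E].

Definition proper_fun (R : realType) (X : tvsType R) (h : X -> \bar R) :=
  (forall x, h x != -oo%E) /\ edom h !=set0.

(* The dual addition [%dE] is the one for which (+oo) - (+oo) = +oo; the
   default one of [%E] gives -oo. *)
Definition esub_fun (R : realType) (X : tvsType R) (f g : X -> \bar R)
    : X -> \bar R :=
  fun x => (f x - g x)%dE.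

Definition global_minimizer (R : realType) (X : tvsType R) (h : X -> \bar R)
    (a : X) :=
  edom h a /\ forall x, (h a <= h x)%E.

Definition e_convex_set (R : realType) (Y : tvsType R) (C : set Y) :=
  forall y0, ~ C y0 ->
    exists ys : cdual Y, forall y, C y -> ys (y - y0) < 0.

Definition epigraph (R : realType) (X : tvsType R) (g : X -> \bar R)
    : set (X * R^o)%type :=
  [set p | (g p.1 <= (p.2 : R)%:E)%E].

(* The topology of X enters only through its continuous linear functionals.
   Since X and (X, sigma(X, X^* )) have the same continuous dual, so do
   X * R and (X, sigma(X, X^* )) * R, and e-convexity in either product is the
   same notion. *)
Definition e_convex (R : realType) (X : tvsType R) (g : X -> \bar R) :=
  e_convex_set (epigraph g).

Definition Wspace (R : realType) (X : tvsType R) : Type :=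
  (cdual X * cdual X * R)%type.

Definition coupling (R : realType) (X : tvsType R) (x : X) (w : Wspace X) : \bar R :=
  let: (xs, us, alpha) := w in
  if us x < alpha then (xs x : R)%:E else +oo%E.

(* For proper h no difference below is indeterminate: h x0 is finite, and so is
   coupling x0 w, as us x0 < alpha. *)
Definition eps_c_subdiff (R : realType) (X : tvsType R) (eps : R)
    (h : X -> \bar R) (x0 : X) : set (Wspace X) :=
  [set w : Wspace X | [/\ h x0 \is a fin_num,
     (let: (xs, us, alpha) := w in us x0 < alpha) &
     forall x, (h x - h x0 >= coupling x w - coupling x0 w - eps%:E)%E]].

(* Main.v *)
Require Import Defs.
From mathcomp Require Import all_boot all_order all_algebra.
From mathcomp Require Import all_classical all_reals all_analysis.

Import Order.TTheory GRing.Theory Num.Theory.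
Import numFieldNormedType.Exports.

Local Open Scope classical_set_scope.
Local Open Scope ring_scope.

(** Minimality of [f - g] at [a] makes the increments of [f] from [a] dominate those of [g], so the
    lower bound on increments that puts [w] in the subdifferential of [g] passes to [f]. *)

Theorem corollary5p5 (R : realType) (X : tvsType R)
    (hX : hausdorff_space X) (hX0 : nontrivial X)
    (f g : X -> \bar R) (hf : proper_fun f) (hg : proper_fun g) (hge : e_convex g)
    (a : X) (ha : global_minimizer (esub_fun f g) a) :
  forall eps : R, 0 <= eps ->
    eps_c_subdiff eps g a `<=` eps_c_subdiff eps f a.
Proof.
move=> eps _ w [ga_fin w_a w_sub].
case: hf => f_Noo _; case: hg => g_Noo _; case: ha => + amin.
rewrite /edom /= /esub_fun => fga.
have fa_fin : f a \is a fin_num.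
  (* With [g a] finite, [f a = +oo] would put [a] outside the domain of the difference. *)
  by move: (f_Noo a) fga ga_fin; case: (f a) => //; case: (g a).
(* Minimality gives f x - f a >= g x - g a, including where g x = +oo: there
   f x = +oo, as otherwise (f - g)(x) = -oo would be below the finite value
   (f - g)(a). *)
split=> // x; apply: le_trans (w_sub x) _.
move: (amin x) (f_Noo x) (g_Noo x); rewrite /esub_fun.
move: fa_fin ga_fin; case: (f a) => // fa _; case: (g a) => // ga _.
case: (f x) => [fx| |] //; case: (g x) => [gx| |] //=.
(* Both values real: swap [g a] and [f a] across the inequality. *)
- move=> + _ _; rewrite -!EFinB !lee_fin.
  by rewrite !lerBrDr addrAC [fa + gx]addrC addrAC.
- by move=> _ _ _; rewrite leey.
Qed.
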